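(* Let $H$ be a complex separable Hilbert space and let $T\in\mathcal{B}(H)$ be idempotent, i.e. $T^2=T$. If $T\in\mathcal{AN}(H)$, then $T+T^*-I\in\mathcal{AN}(H)$.
   Context: Throughout, Hilbert spaces are infinite dimensional. $\mathcal{B}(H)$ denotes bounded linear operators on $H$. $S\in\mathcal{B}(H)$ is norm attaining if $\|Sx\|=\|S\|$ for some unit vector $x$; $S\in\mathcal{AN}(H)$ (absolutely norm attaining) if for every nonzero closed subspace $M\subseteq H$ the restriction $S|_M:M\to H$ is norm attaining. *)

(* Defs.v *)
(* MathComp + MathComp-Analysis (reals) + mathcomp-real-closed complex numbers. *)
From HB Require Import structures.
From mathcomp Require Import all_boot all_order all_algebra.
From mathcomp Require Import classical_sets reals.
From mathcomp Require Import complex.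
Set Implicit Arguments. Unset Strict Implicit. Unset Printing Implicit Defensive.
Import Order.TTheory GRing.Theory Num.Theory.
Local Open Scope ring_scope.
Local Open Scope classical_set_scope.

(* A complex Hilbert space is modelled as a module H over C = R[i] together
   with an inner product ip (linear in the first, conjugate-linear in the
   second argument), complete for the induced norm. *)
Section Hilbert.
Variables (R : realType) (H : lmodType R[i]) (ip : H -> H -> R[i]).

Definition hnorm (x : H) : R := Num.sqrt (complex.Re (ip x x)).

Definition is_inner_product : Prop :=
  [/\ (forall (a : R[i]) (x y z : H), ip (a *: x + y) z = a * ip x z + ip y z),
      (forall x y : H, ip y x = (ip x y)^*),
      (forall x : H, 0 <= complex.Re (ip x x)) &
      (forall x : H, ip x x = 0 -> x = 0)].

Definition converges_to (u : nat -> H) (x : H) : Prop :=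
  forall e : R, 0 < e -> exists N : nat, forall n, (N <= n)%N -> hnorm (u n - x) < e.

Definition is_cauchy (u : nat -> H) : Prop :=
  forall e : R, 0 < e -> exists N : nat,
    forall m n, (N <= m)%N -> (N <= n)%N -> hnorm (u m - u n) < e.

Definition is_complete : Prop :=
  forall u : nat -> H, is_cauchy u -> exists x, converges_to u x.

Definition is_separable : Prop :=
  exists d : nat -> H, forall (x : H) (e : R), 0 < e -> exists n, hnorm (x - d n) < e.

(* infinite dimensional: orthonormal families of every finite size *)
Definition is_infinite_dimensional : Prop :=
  forall n : nat, exists f : 'I_n -> H,
    forall i j : 'I_n, ip (f i) (f j) = (i == j)%:R.

Definition separable_infdim_complex_Hilbert : Prop :=
  [/\ is_inner_product, is_complete, is_separable & is_infinite_dimensional].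

(* bounded linear operators B(H) *)
Definition is_bounded_operator (S : H -> H) : Prop :=
  (forall (a : R[i]) (x y : H), S (a *: x + y) = a *: S x + S y) /\
  exists M : R, forall x, hnorm (S x) <= M * hnorm x.

Definition is_adjoint (S Sadj : H -> H) : Prop :=
  forall x y : H, ip (S x) y = ip x (Sadj y).

Definition is_closed_subspace (M : set H) : Prop :=
  [/\ M 0,
      (forall (a : R[i]) (x y : H), M x -> M y -> M (a *: x + y)) &
      (forall (u : nat -> H) (x : H), (forall n, M (u n)) -> converges_to u x -> M x)].

Definition nonzero_set (M : set H) : Prop := exists x, M x /\ x <> 0.

(* operator norm of the restriction S|_M : M -> H *)
Definition restr_opnorm (S : H -> H) (M : set H) : R :=
  sup [set r : R | exists x, M x /\ hnorm x <= 1 /\ r = hnorm (S x)].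

Definition norm_attaining_on (S : H -> H) (M : set H) : Prop :=
  exists x, M x /\ hnorm x = 1 /\ hnorm (S x) = restr_opnorm S M.

(* absolutely norm attaining operators AN(H) *)
Definition abs_norm_attaining (S : H -> H) : Prop :=
  forall M : set H, is_closed_subspace M -> nonzero_set M -> norm_attaining_on S M.

End Hilbert.

(* Main.v *)
Require Import Defs.
From HB Require Import structures.
From mathcomp Require Import all_boot all_order all_algebra.
From mathcomp Require Import classical_sets reals.
From mathcomp Require Import complex.
From mathcomp Require Import boolp ring lra.
Import Order.TTheory GRing.Theory Num.Theory.
Local Open Scope ring_scope.

(* Since T is idempotent, S = T + T^* - I and D = T - T^* satisfy
   |S x|^2 = |x|^2 + |D x|^2.  If T is absolutely norm attaining, then its
   kernel or the range of T^* has finite dimension.  Otherwise, as T does not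
   decrease norms on the range of T^*, which is orthogonal to the kernel, one
   finds an orthonormal sequence g_n with pairwise orthogonal images of norms
   1 - 1/(n+2), and T does not attain its norm on the closed span of the g_n.
   Hence D has finite rank, and this forces S to attain its norm on every
   nonzero closed subspace. *)

(** * The real inner product and its norm *)

Section RealInnerProduct.
Local Set Implicit Arguments.
Local Unset Strict Implicit.
Variables (R : realType) (H : lmodType R[i]) (ip : H -> H -> R[i]).
Hypothesis hip : is_inner_product ip.

Local Notation "r *:r x" := (r%:C%C *: x) (at level 40).
Local Notation hnorm := (hnorm ip).

(* H is handled as a real Hilbert space; the complex structure matters only for
   the closed span, which must be a complex subspace. *)
Definition rip (x y : H) : R := complex.Re (ip x y).

Definition real_linear (F : H -> H) : Prop :=
  forall (r : R) (x y : H), F (r *:r x + y) = r *:r F x + F y.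

Lemma ripC x y : rip x y = rip y x.
Proof. by case: hip => _ h _ _; rewrite /rip (h x y); case: (ip x y). Qed.

Lemma ripDZl r x y z : rip (r *:r x + y) z = r * rip x z + rip y z.
Proof.
case: hip => h _ _ _; rewrite /rip h.
by case: (ip x z) => a b; case: (ip y z) => c d /=; rewrite mul0r subr0.
Qed.

Lemma ripDl x y z : rip (x + y) z = rip x z + rip y z.
Proof. by have := ripDZl 1 x y z; rewrite scale1r mul1r. Qed.

Lemma rip0l z : rip 0 z = 0.
Proof. by apply: (addrI (rip 0 z)); rewrite -ripDl !addr0. Qed.

Lemma ripZl r x z : rip (r *:r x) z = r * rip x z.
Proof. by rewrite -[_ *: _]addr0 ripDZl rip0l addr0. Qed.

Lemma ripNl x z : rip (- x) z = - rip x z.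
Proof.
by apply: (addrI (rip x z)); rewrite -ripDl !subrr rip0l.
Qed.

Lemma ripDr x y z : rip z (x + y) = rip z x + rip z y.
Proof. by rewrite ripC ripDl !(ripC z). Qed.

Lemma ripZr r x z : rip z (r *:r x) = r * rip z x.
Proof. by rewrite ripC ripZl (ripC z). Qed.

Lemma ripNr x z : rip z (- x) = - rip z x.
Proof. by rewrite ripC ripNl (ripC z). Qed.

Lemma rip0r z : rip z 0 = 0.
Proof. by rewrite ripC rip0l. Qed.

Definition ripE := (ripDl, ripDr, ripNl, ripNr, ripZl, ripZr, rip0l, rip0r).

Lemma ripZZ (a : R[i]) x y :
  rip (a *: x) (a *: y) =
  (complex.Re a ^+ 2 + complex.Im a ^+ 2) * rip x y.
Proof.
have [h hC _ _] := hip.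
have hZ c u v : ip (c *: u) v = c * ip u v.
  have h0 : ip 0 v = 0.
    by apply: (addrI (ip 0 v)); rewrite -{1}[ip 0 v]mul1r -h scaler0 !addr0.
  by rewrite -[c *: u]addr0 h h0 addr0.
rewrite /rip hZ hC hZ [ip x y]hC.
case: (ip y x) => p q; case: a => c d /=; ring.
Qed.

Lemma rip_ge0 x : 0 <= rip x x.
Proof. by case: hip => _ _ h _; exact: h. Qed.

Lemma rip_eq0 x : rip x x = 0 -> x = 0.
Proof.
case: hip => _ hC _ h0 hx; apply: h0.
move: hx (hC x x); rewrite /rip; case: (ip x x) => a b /= -> [hb].
by congr Complex; lra.
Qed.

Lemma hnorm_ge0 x : 0 <= hnorm x.
Proof. exact: sqrtr_ge0. Qed.

Lemma hnorm_sq x : hnorm x ^+ 2 = rip x x.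
Proof. by rewrite sqr_sqrtr // rip_ge0. Qed.

Lemma hnorm0_eq0 x : hnorm x = 0 -> x = 0.
Proof. by move=> h; apply: rip_eq0; rewrite -hnorm_sq h expr0n. Qed.

Lemma hnorm0 : hnorm 0 = 0.
Proof. by rewrite /hnorm -/(rip 0 0) rip0l sqrtr0. Qed.

Lemma hnorm_gt0 x : x <> 0 -> 0 < hnorm x.
Proof.
by move=> hx; rewrite lt_def hnorm_ge0 andbT; apply/eqP => /hnorm0_eq0.
Qed.

Lemma hnormN x : hnorm (- x) = hnorm x.
Proof. by rewrite /hnorm -/(rip _ _) -/(rip _ _) !ripE opprK. Qed.

Lemma hnormZ r x : hnorm (r *:r x) = `|r| * hnorm x.
Proof.
apply/eqP; rewrite -(eqrXn2 (n := 2)) ?mulr_ge0 ?hnorm_ge0 // exprMn !hnorm_sq.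
by rewrite !ripE real_normK ?num_real //; apply/eqP; ring.
Qed.

Lemma rip_le x y : rip x y <= hnorm x * hnorm y.
Proof.
have [y0|/eqP yN0] := eqVneq y 0; first by rewrite y0 rip0r hnorm0 mulr0.
have [x0|/eqP xN0] := eqVneq x 0; first by rewrite x0 rip0l hnorm0 mul0r.
have := rip_ge0 (hnorm y *:r x - hnorm x *:r y).
rewrite !ripE -!hnorm_sq (ripC y x).
have hx := hnorm_gt0 xN0; have hy := hnorm_gt0 yN0.
have hxy : 0 < hnorm x * hnorm y by rewrite mulr_gt0.
move=> h; rewrite -(ler_pM2l hxy); nra.
Qed.

Lemma rip_abs_le x y : `|rip x y| <= hnorm x * hnorm y.
Proof.
by rewrite ler_norml rip_le andbT lerNl -ripNl -(hnormN x) rip_le.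
Qed.

Lemma hnormD x y : hnorm (x + y) <= hnorm x + hnorm y.
Proof.
rewrite -ler_sqr ?nnegrE ?addr_ge0 ?hnorm_ge0 // sqrrD !hnorm_sq !ripE.
have := rip_le x y; rewrite (ripC y x); lra.
Qed.

Lemma hnormB x y : hnorm (x - y) = hnorm (y - x).
Proof. by rewrite -hnormN opprB. Qed.

Lemma hnorm_triangle x y z : hnorm (x - z) <= hnorm (x - y) + hnorm (y - z).
Proof. by have := hnormD (x - y) (y - z); rewrite addrA subrK. Qed.

Lemma hnorm_lip x y : hnorm x <= hnorm y + hnorm (x - y).
Proof. by have := hnormD y (x - y); rewrite addrC subrK. Qed.

(** * Real-linear maps, adjoints and finite rank *)

(** Encodes finite dimension without bases: if [F x = 0] whenever [rorth x l], then [F] has finite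
    rank; if only [0] in [K] satisfies [rorth x l], then [K] is finite dimensional. *)
Definition rorth (x : H) (l : seq H) := forall v, v \in l -> rip x v = 0.

Lemma real_linearD F : real_linear F -> {morph F : x y / x + y}.
Proof. by move=> hF x y; have := hF 1 x y; rewrite !scale1r. Qed.

Lemma real_linear0 F : real_linear F -> F 0 = 0.
Proof.
by move=> hF; apply: (addrI (F 0)); rewrite -(real_linearD hF) !addr0.
Qed.

Lemma real_linearZ F r x : real_linear F -> F (r *:r x) = r *:r F x.
Proof. by move=> hF; have := hF r x 0; rewrite (real_linear0 hF) !addr0. Qed.

Lemma real_linearN F : real_linear F -> {morph F : x / - x}.
Proof.
move=> hF x; apply: (addrI (F x)).
by rewrite -(real_linearD hF) !subrr (real_linear0 hF).
Qed.

Lemma real_linearB F : real_linear F -> {morph F : x y / x - y}.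
Proof. by move=> hF x y; rewrite (real_linearD hF) (real_linearN hF). Qed.

Lemma adjoint_real_linear P Q : (forall x y, rip (P x) y = rip x (Q y)) ->
  real_linear Q.
Proof.
move=> hPQ r x y; apply/eqP; rewrite -subr_eq0; apply/eqP/rip_eq0.
set z := _ - _; rewrite {2}/z !ripE -!hPQ !ripE; ring.
Qed.

(* Each step cuts K down to a hyperplane, and keeps a vector of K outside it. *)
Lemma finite_dim_witness (K : set H) (l : seq H) :
  (forall r x y, K x -> K y -> K (r *:r x + y)) ->
  (forall x, K x -> rorth x l -> x = 0) ->
  exists w, forall x, rorth x w -> forall k, K k -> rip x k = 0.
Proof.
elim: l K => [|a l IH] K hK hl.
  by exists [::] => x _ k Kk; rewrite (hl k Kk) ?rip0r.
have [w hw] : exists w, forall x, rorth x w ->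
    forall k, K k /\ rip k a = 0 -> rip x k = 0.
  apply: (IH (fun k => K k /\ rip k a = 0)).
    move=> r x y [Kx ax] [Ky ay]; split; first exact: hK.
    by rewrite ripDZl ax ay mulr0 addr0.
  move=> x [Kx ax] xl; apply: hl => // v; rewrite inE => /orP[/eqP->|] //.
  exact: xl.
have [[k [Kk ka]]|none] := pselect (exists k, K k /\ rip k a <> 0).
  exists (k :: w) => x hx y Ky.
  have xk : rip x k = 0 by apply: hx; rewrite mem_head.
  (* This combination is [y] moved along [k] into the hyperplane orthogonal to [a], where [hw]
     applies. *)
  have /hw/(_ (- (rip y a / rip k a) *:r k + y)) : rorth x w.
    by move=> v vw; apply: hx; rewrite inE vw orbT.
  rewrite !ripE xk mulr0 add0r; apply; split; first exact: hK.
  by field; apply/eqP.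
exists w => x hx k Kk; apply: hw => //; split=> //.
by apply: contrapT => ka; apply: none; exists k.
Qed.

(** A finite-dimensional range of [P] forces both [P] and its adjoint [Q] to have finite rank:
    orthogonality to [map Q l] makes [P x] orthogonal to [l], and orthogonality to the range of [P]
    gives |Q x|^2 = <P (Q x), x> = 0. *)
Lemma range_finite_dim P Q (l : seq H) :
  real_linear P -> (forall x y, rip (P x) y = rip x (Q y)) ->
  (forall x, rorth (P x) l -> P x = 0) ->
  exists w, forall x, rorth x w -> P x = 0 /\ Q x = 0.
Proof.
move=> hP hPQ hl.
have [||w hw] := @finite_dim_witness (range P) l.
- by move=> r _ _ [x _ <-] [y _ <-]; exists (r *:r x + y); rewrite ?hP.
- by move=> _ [y _ <-]; exact: hl.
exists (w ++ map Q l) => x hx; split.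
  apply: hl => v vl; rewrite hPQ; apply: hx.
  by rewrite mem_cat map_f ?orbT.
apply: rip_eq0; rewrite -hPQ ripC; apply: hw; last by exists (Q x).
by move=> v vw; apply: hx; rewrite mem_cat vw.
Qed.

(** * Subsequences and compactness of finite-rank maps *)

Lemma inv_succ_small (e : R) : 0 < e ->
  exists N, forall n, (N <= n)%N -> n.+1%:R^-1 < e.
Proof.
move=> /ltr_add_invr[N]; rewrite add0r => hN; exists N => n hn.
by apply: le_lt_trans hN; rewrite lef_pV2 ?posrE ?ltr0n // ler_nat.
Qed.

(** The limit is the limit superior, the supremum of the set [A] of reals exceeded at arbitrarily
    large indices. Monotonicity of [phi] is replaced by [n <= phi n], which is enough for tail
    estimates. *)
Lemma bounded_subseq_cvg (u : nat -> R) (B : R) : (forall n, `|u n| <= B) ->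
  exists (phi : nat -> nat) (l : R), (forall n, (n <= phi n)%N) /\
    forall n, `|u (phi n) - l| < n.+1%:R^-1.
Proof.
move=> hu.
pose A := [set x : R | forall N, exists n, (N <= n)%N /\ x < u n]%classic.
have A0 : A (- B - 1).
  by move=> N; exists N; split=> //; have := hu N; rewrite ler_norml; lra.
have AB : ubound A B.
  move=> x /(_ 0%N) [n [_ xu]]; have := hu n; rewrite ler_norml; lra.
have hA : has_sup A by split; [exists (- B - 1) | exists B].
suff /choice[phi hphi] : forall n, exists m, (n <= m)%N /\
    `|u m - sup A| < n.+1%:R^-1.
  by exists phi, (sup A); split=> n; case: (hphi n).
move=> n; have e0 : 0 < n.+1%:R^-1 :> R by rewrite invr_gt0 ltr0n.
set e := n.+1%:R^-1 in e0 *.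
have [x Ax ltx] := sup_adherent e0 hA.
have /existsNP[N hN] : ~ A (sup A + e / 2).
  move=> /(sup_upper_bound hA); lra.
have [m [hm xm]] := Ax (maxn n N).
exists m; split; first by rewrite (leq_trans _ hm) ?leq_maxl.
have : u m <= sup A + e / 2.
  rewrite leNgt; apply/negP => h; apply: hN; exists m; split=> //.
  by rewrite (leq_trans _ hm) ?leq_maxr.
rewrite ltr_norml; lra.
Qed.

Local Notation is_cauchy := (is_cauchy ip).

Lemma cauchy_subseq u (phi : nat -> nat) : (forall n, (n <= phi n)%N) ->
  is_cauchy u -> is_cauchy (u \o phi).
Proof.
move=> hphi hu e /hu[N hN]; exists N => m n hm hn; apply: hN.
  exact: leq_trans hm (hphi m).
exact: leq_trans hn (hphi n).
Qed.

Lemma cauchyDZ u v (r : nat -> R) l z :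
  is_cauchy u -> (forall n, `|r n - l| < n.+1%:R^-1) ->
  (forall n, v n = r n *:r z + u n) -> is_cauchy v.
Proof.
move=> hu hr hv e e0.
have e2 : 0 < e / 2 by lra.
have [N1 hN1] := hu _ e2.
(* The factor 2 pays for two distances to [l]; the [+ 1] covers [z = 0]. *)
have d0 : 0 < e / 2 / (2 * (hnorm z + 1)).
  by rewrite divr_gt0 // mulr_gt0 // ltr_wpDl ?hnorm_ge0.
have [N2 hN2] := inv_succ_small d0.
exists (maxn N1 N2) => m n; rewrite !geq_max => /andP[hm1 hm2] /andP[hn1 hn2].
have -> : v m - v n = (r m - r n) *:r z + (u m - u n).
  by rewrite !hv rmorphB scalerBl opprD addrACA.
apply: le_lt_trans (hnormD _ _) _.
have := hN1 _ _ hm1 hn1.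
suff : hnorm ((r m - r n) *:r z) <= e / 2 by lra.
have hz := hnorm_ge0 z.
have hrd : `|r m - r n| <= e / 2 / (hnorm z + 1).
  have := hN2 _ hm2; have := hN2 _ hn2; move: (hr m) (hr n).
  have -> : e / 2 / (2 * (hnorm z + 1)) = e / 2 / (hnorm z + 1) / 2.
    by field; rewrite gt_eqF //; lra.
  rewrite !ltr_norml ler_norml; move: (e / 2 / _) (m.+1%:R^-1) (n.+1%:R^-1) => q a b; lra.
rewrite hnormZ; apply: le_trans (ler_wpM2r hz hrd) _.
by rewrite mulrAC ler_pdivrMr; nra.
Qed.

(** Induction on [l], splitting off one rank-one term at a time; its scalar coefficients are
    bounded, hence converge along a further subsequence. *)
Lemma finite_rank_precompact D (l : seq H) (u : nat -> H) :
  real_linear D -> (forall x, rorth x l -> D x = 0) ->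
  (forall n, hnorm (u n) <= 1) ->
  exists phi : nat -> nat, (forall n, (n <= phi n)%N) /\ is_cauchy (D \o u \o phi).
Proof.
move=> hD + hu; elim: l D hD => [|a l IH] D hD hl.
  exists id; split=> // e e0; exists 0%N => m n _ _ /=.
  by rewrite !hl // subrr hnorm0.
have [[z0 [z0l z0a]]|none] := pselect (exists z, rorth z l /\ rip z a <> 0); last first.
  apply: (IH D hD) => x xl; apply: hl => v; rewrite inE => /orP[/eqP->|]; last exact: xl.
  by apply: contrapT => xa; apply: none; exists x.
have {z0 z0l z0a} [z [za zl]] : exists z, rip z a = 1 /\ rorth z l.
  exists ((rip z0 a)^-1 *:r z0); split.
    by rewrite ripZl mulVf //; apply/eqP.
  by move=> v vl; rewrite ripZl (z0l v vl) mulr0.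
(* [D' x] is [D] at [x - rip x a *:r z], which is orthogonal to [a], and to [l] when [x] is; so [D']
   needs only the shorter list. *)
pose D' x := D x - rip x a *:r D z.
have hD' : real_linear D'.
  move=> r x y; rewrite /D' hD ripDZl rmorphD rmorphM scalerBr scalerDl scalerA.
  by rewrite opprD addrACA.
have [|phi [hphi cphi]] := IH D' hD'.
  move=> x xl; rewrite /D' -(real_linearZ _ _ hD) -(real_linearB hD); apply: hl.
  move=> v; rewrite inE => /orP[/eqP->|vl]; rewrite !ripE; first by rewrite za; ring.
  by rewrite (xl v vl) (zl v vl); ring.
have hb n : `|rip (u (phi n)) a| <= hnorm a.
  apply: le_trans (rip_abs_le _ _) _.
  by rewrite ler_piMl ?hnorm_ge0.
have [psi [c [hpsi cpsi]]] := bounded_subseq_cvg hb.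
exists (phi \o psi); split; first by move=> n; apply: leq_trans (hpsi n) (hphi _).
apply: (cauchyDZ (cauchy_subseq hpsi cphi) cpsi (z := D z)) => n /=.
by rewrite /D' addrC subrK.
Qed.

End RealInnerProduct.

(** * Norm attainment from a finite-rank defect *)

Section Attaining.
Local Set Implicit Arguments.
Local Unset Strict Implicit.
Variables (R : realType) (H : lmodType R[i]) (ip : H -> H -> R[i]).
Hypothesis hip : is_inner_product ip.

Local Notation "r *:r x" := (r%:C%C *: x) (at level 40).
Local Notation hnorm := (hnorm ip).
Local Notation rip := (rip ip).
Local Notation ripE := (ripE hip).
Local Notation real_linear := (@real_linear R H).
Local Notation rorth := (rorth ip).

Lemma parallelogram x y :
  hnorm (x - y) ^+ 2 + hnorm (x + y) ^+ 2 = 2 * hnorm x ^+ 2 + 2 * hnorm y ^+ 2.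
Proof. rewrite !(hnorm_sq hip) !ripE; ring. Qed.

Lemma restr_opnorm_has_sup S M (B : R) :
  M 0 -> (forall x, hnorm (S x) <= B * hnorm x) ->
  has_sup [set r : R | exists x, M x /\ hnorm x <= 1 /\ r = hnorm (S x)]%classic.
Proof.
move=> M0 hB; split.
  by exists (hnorm (S 0)), 0; rewrite (hnorm0 hip).
exists `|B| => _ [x [_ [x1 ->]]]; apply: le_trans (hB x) _.
apply: le_trans (ler_norm _) _; rewrite normrM (ger0_norm (hnorm_ge0 ip x)).
by rewrite ler_piMr.
Qed.

(* For s the norm of S on M, the form q x = s^2 |x|^2 - |S x|^2 is nonnegative
   on M and equals (s^2 - 1) |x|^2 - |D x|^2.  By the parallelogram law it is
   small at the differences of a maximizing sequence, so that once D converges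
   along this sequence, so does the sequence itself. *)
Lemma finite_rank_defect_attaining S D (l : seq H) (B : R) :
  is_complete ip -> real_linear S -> real_linear D ->
  (forall x, hnorm (S x) <= B * hnorm x) ->
  (forall x, hnorm (S x) ^+ 2 = hnorm x ^+ 2 + hnorm (D x) ^+ 2) ->
  (forall x, rorth x l -> D x = 0) ->
  abs_norm_attaining ip S.
Proof.
move=> hcpl hS hD hB hSD hl M [M0 Mlin Mcl] [y [My y0]].
have hsup := restr_opnorm_has_sup M0 hB.
rewrite /norm_attaining_on; set s := restr_opnorm ip S M.
have nge := hnorm_ge0 ip.
have Mnormal x : M x -> x <> 0 -> exists2 z, M z &
    hnorm z = 1 /\ hnorm (S z) = (hnorm x)^-1 * hnorm (S x).
  move=> Mx x0; have nx := hnorm_gt0 hip x0.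
  exists ((hnorm x)^-1 *:r x); first by rewrite -[_ *: x]addr0; exact: Mlin.
  rewrite (real_linearZ _ _ hS) !(hnormZ hip) gtr0_norm ?invr_gt0 //.
  by rewrite mulVf // gt_eqF.
have leS x : M x -> hnorm (S x) <= s * hnorm x.
  move=> Mx; have [->|/eqP x0] := eqVneq x 0.
    by rewrite (real_linear0 hS) (hnorm0 hip) mulr0.
  have [z Mz [z1 zS]] := Mnormal x Mx x0.
  have nx := hnorm_gt0 hip x0.
  rewrite -ler_pdivrMr // mulrC -zS.
  by apply: sup_upper_bound => //; exists z; rewrite z1.
have ge1 x : hnorm x <= hnorm (S x).
  by rewrite -ler_sqr ?nnegrE // hSD lerDl sqr_ge0.
have [x0 Mx0 [x01 _]] := Mnormal y My y0.
have s1 : 1 <= s by have := leS x0 Mx0; have := ge1 x0; rewrite x01; lra.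
(* If [s = 1], every unit vector of [M] attains the norm, since [S] does not decrease norms. *)
have [sle|slt] := leP s 1.
  exists x0; split=> //; split=> //; apply: le_anti.
  by have := leS x0 Mx0; have := ge1 x0; rewrite x01; lra.
have /choice[u hu] : forall n, exists x, [/\ M x, hnorm x <= 1 &
    s - n.+1%:R^-1 < hnorm (S x)].
  move=> n; have e0 : 0 < n.+1%:R^-1 :> R by rewrite invr_gt0 ltr0n.
  by have [_ [x [Mx [x1 ->]]] xlt] := sup_adherent e0 hsup; exists x.
have [|phi [hphi cphi]] := finite_rank_precompact hip (u := u) hD hl.
  by move=> n; case: (hu n).
pose v := u \o phi.
have Mv n : M (v n) by case: (hu (phi n)).
have v1 n : hnorm (v n) <= 1 by case: (hu (phi n)).
have vS n : s - n.+1%:R^-1 < hnorm (S (v n)).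
  case: (hu (phi n)) => _ _; apply: le_lt_trans; rewrite lerB //.
  by rewrite lef_pV2 ?posrE ?ltr0n // ler_nat ltnS.
(* With c = 1/(n+1), the left side is at most s^2 - (s - c)^2 <= 2 s c; squaring is legitimate
   because c <= 1 <= s. *)
have qv n : s ^+ 2 * hnorm (v n) ^+ 2 - hnorm (S (v n)) ^+ 2 <= 2 * s * n.+1%:R^-1.
  have := v1 n; have := vS n; have := nge (v n); have := nge (S (v n)).
  have : 0 < n.+1%:R^-1 :> R by rewrite invr_gt0 ltr0n.
  have : n.+1%:R^-1 <= 1 :> R by rewrite invf_le1 ?ltr0n // ler1n.
  move: (hnorm (v n)) (hnorm (S _)) n.+1%:R^-1 => a b c.
  move=> c1 c0 b0 a0 bc a1; have : a ^+ 2 <= 1 by nra.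
  have : (s - c) ^+ 2 <= b ^+ 2 by nra.
  nra.
(* q(a - b) = 2 q(a) + 2 q(b) - q(a + b), the last value is nonnegative on [M], and [qv] bounds the
   others; hence the factor 4 s. *)
have qB m n : (s ^+ 2 - 1) * hnorm (v m - v n) ^+ 2 <=
    4 * s * (m.+1%:R^-1 + n.+1%:R^-1) + hnorm (D (v m) - D (v n)) ^+ 2.
  have := parallelogram (v m) (v n).
  have := parallelogram (S (v m)) (S (v n)).
  rewrite -(real_linearB hS) -(real_linearB hD) -(real_linearD hS).
  have := hSD (v m - v n).
  have : hnorm (S (v m + v n)) ^+ 2 <= s ^+ 2 * hnorm (v m + v n) ^+ 2.
    rewrite -exprMn ler_sqr ?nnegrE ?nge ?mulr_ge0 ?nge //; last lra.
    by apply: leS; have := Mlin 1 _ _ (Mv m) (Mv n); rewrite scale1r.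
  have := qv m; have := qv n.
  move: m.+1%:R^-1 n.+1%:R^-1 => a b.
  move: (hnorm (v m - v n)) (hnorm (v m + v n)) (hnorm (S (v m - v n)))
    (hnorm (S (v m + v n))) (hnorm (D _)) (hnorm (v m)) (hnorm (v n))
    (hnorm (S (v m))) (hnorm (S (v n))) => X1 X2 X3 X4 X5 X6 X7 X8 X9.
  move=> h1 h2 h3 h4 h5 h6.
  have : s ^+ 2 * (X1 ^+ 2 + X2 ^+ 2) = s ^+ 2 * (2 * X6 ^+ 2 + 2 * X7 ^+ 2) by rewrite h6.
  lra.
have cv : is_cauchy ip v.
  move=> e e0.
  have d0 : 0 < (s ^+ 2 - 1) * e ^+ 2 by rewrite mulr_gt0 ?exprn_gt0 // subr_gt0 exprn_egt1.
  set d := _ * _ in d0.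
  have [|N1 hN1] := cphi (Num.sqrt (d / 2)); first by rewrite sqrtr_gt0; lra.
  (* Each of the two terms 4 s/(k+1) in [qB] then stays below d/4, and the [D] term takes the
     remaining d/2. *)
  have [|N2 hN2] := @inv_succ_small R (d / (16 * s)).
    by rewrite divr_gt0 // mulr_gt0 //; lra.
  exists (maxn N1 N2) => m n; rewrite !geq_max => /andP[hm1 hm2] /andP[hn1 hn2].
  have hDD : hnorm (D (v m) - D (v n)) ^+ 2 < d / 2.
    rewrite -[X in _ < X]sqr_sqrtr ?divr_ge0 ?(ltW d0) //.
    by rewrite ltr_sqr ?nnegrE ?nge ?sqrtr_ge0 //; exact: hN1.
  have hh k : (N2 <= k)%N -> 4 * s * k.+1%:R^-1 < d / 4.
    move=> /hN2; rewrite ltr_pdivlMr; last lra.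
    move: k.+1%:R^-1 => a; lra.
  have : hnorm (v m - v n) ^+ 2 < e ^+ 2.
    rewrite -(ltr_pM2l (x := s ^+ 2 - 1)) ?subr_gt0 ?exprn_egt1 // -/d.
    have := qB m n; have := hh _ hm2; have := hh _ hn2.
    move: m.+1%:R^-1 n.+1%:R^-1 (hnorm (v m - v n)) (hnorm (D _ - _)) hDD.
    move: {hN1 hN2 hh} (d) => d' a b X Y; lra.
  by rewrite ltr_sqr ?nnegrE ?nge ?(ltW e0).
have [x hx] := hcpl v cv.
have Mx : M x by exact: Mcl hx.
have x1 : hnorm x <= 1.
  apply/ler_addgt0Pr => e /hx[N /(_ N (leqnn N)) hN].
  have := hnorm_lip hip x (v N); rewrite (hnormB hip).
  have := v1 N; lra.
have sx : s <= hnorm (S x).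
  apply/ler_addgt0Pr => e e0.
  have [|N1 hN1] := hx (e / (2 * s)); first by rewrite divr_gt0 // mulr_gt0 //; lra.
  have [|N2 hN2] := @inv_succ_small R (e / 2); first lra.
  pose n := maxn N1 N2.
  have := hN1 n (leq_maxl _ _); rewrite ltr_pdivlMr; last lra.
  have := hN2 n (leq_maxr _ _); have := vS n.
  have := hnorm_lip hip (S (v n)) (S x); rewrite -(real_linearB hS).
  have : M (v n - x) by have := Mlin (-1) _ _ Mx (Mv n); rewrite scaleN1r addrC.
  move=> /leS; move: n.+1%:R^-1 => a; lra.
(* From s <= |S x| <= s |x| <= s, both |x| = 1 and |S x| = s follow. *)
have := leS x Mx => Sx.
exists x; split=> //; split; apply: le_anti; apply/andP; split=> //; nra.
Qed.

End Attaining.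

(** * Complex scalars and closed spans of sequences *)

Section NonAttaining.
Local Set Implicit Arguments.
Local Unset Strict Implicit.
Variables (R : realType) (H : lmodType R[i]) (ip : H -> H -> R[i]).
Hypothesis hip : is_inner_product ip.

Local Notation "r *:r x" := (r%:C%C *: x) (at level 40).
Local Notation hnorm := (hnorm ip).
Local Notation rip := (rip ip).
Local Notation ripE := (ripE hip).
Local Notation real_linear := (@real_linear R H).
Local Notation "'i" := ('i%C : R[i]).

Lemma scale_ReIm (c : R[i]) (x : H) :
  c *: x = complex.Re c *:r x + complex.Im c *:r ('i *: x).
Proof. by rewrite {1}[c]complexE scalerDl scalerA [_%:C%C * _]mulrC. Qed.

Lemma scale_ii (x : H) : 'i *: ('i *: x) = - x.
Proof. by rewrite scalerA -expr2 sqr_i scaleN1r. Qed.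

Lemma rip_ii x y : rip ('i *: x) ('i *: y) = rip x y.
Proof. rewrite (ripZZ hip) /=; ring. Qed.

Lemma rip_il x y : rip ('i *: x) y = - rip x ('i *: y).
Proof. by rewrite -rip_ii scale_ii ripE. Qed.

Lemma hnorm_i x : hnorm ('i *: x) = hnorm x.
Proof. by rewrite /Defs.hnorm -/(rip _ _) -/(rip _ _) rip_ii. Qed.

(** Real orthogonality to both [y] and ['i *: y] amounts to complex orthogonality, as multiplication
    by ['i] is skew for [rip]. *)
Lemma rip_scale0 x y : rip x y = 0 -> rip x ('i *: y) = 0 ->
  forall c d, rip (c *: x) (d *: y) = 0.
Proof.
move=> h1 h2 c d; rewrite (scale_ReIm c) (scale_ReIm d) !ripE rip_ii rip_il h1 h2.
ring.
Qed.

Lemma hnormZ_le (c : R[i]) : exists2 C : R, 0 <= C & forall x, hnorm (c *: x) <= C * hnorm x.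
Proof.
exists (`|complex.Re c| + `|complex.Im c|); first by rewrite addr_ge0.
move=> x; rewrite scale_ReIm; apply: le_trans (hnormD hip _ _) _.
by rewrite !(hnormZ hip) hnorm_i mulrDl.
Qed.

Lemma complex_linearZ (F : H -> H) :
  (forall (a : R[i]) x y, F (a *: x + y) = a *: F x + F y) ->
  forall a x, F (a *: x) = a *: F x.
Proof.
move=> hF a x; have F0 : F 0 = 0 by apply: (@real_linear0 R H) => r; exact: hF.
by have := hF a x 0; rewrite F0 !addr0.
Qed.

Fixpoint partial_span (g : nat -> H) (n : nat) : set H :=
  if n is m.+1 then
    fun z => exists y c, partial_span g m y /\ z = y + c *: g m
  else fun z => z = 0.

Definition closed_span (g : nat -> H) : set H :=
  fun x => forall e : R, 0 < e ->
    exists n y, partial_span g n y /\ hnorm (x - y) < e.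

Lemma partial_span_mono g m n y :
  (m <= n)%N -> partial_span g m y -> partial_span g n y.
Proof.
move=> /subnKC <-; elim: (n - m)%N => [|k IH]; first by rewrite addn0.
by move=> /IH hy; rewrite addnS; exists y, 0; rewrite scale0r addr0.
Qed.

Lemma partial_span_lin g n (a : R[i]) x y :
  partial_span g n x -> partial_span g n y -> partial_span g n (a *: x + y).
Proof.
elim: n x y => [|n IH] x y /=; first by move=> -> ->; rewrite scaler0 addr0.
move=> [x' [c [hx ->]]] [y' [d [hy ->]]].
exists (a *: x' + y'), (a * c + d); split; first exact: IH.
by rewrite scalerDr scalerDl scalerA addrACA.
Qed.

Lemma mem_partial_span g n : partial_span g n.+1 (g n).
Proof.
exists 0, 1; rewrite add0r scale1r; split=> //.
by elim: n => [|n IH] //; exists 0, 0; rewrite scale0r addr0.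
Qed.

Lemma sub_closed_span g n y : partial_span g n y -> closed_span g y.
Proof. by move=> hy e e0; exists n, y; rewrite subrr (hnorm0 hip). Qed.

Lemma closed_span_subspace g : is_closed_subspace ip (closed_span g).
Proof.
split.
- exact: (@sub_closed_span _ 0).
- move=> a x y hx hy e e0; have [C C0 hC] := hnormZ_le a.
  have [|m [x' [mx' dx]]] := hx (e / 2 / (C + 1)).
    by rewrite !divr_gt0 // ltr_wpDl.
  have [|n [y' [ny' dy]]] := hy (e / 2); first lra.
  exists (maxn m n), (a *: x' + y'); split.
    by apply: partial_span_lin; [move: mx' | move: ny'];
       apply: partial_span_mono; rewrite ?leq_maxl ?leq_maxr.
  rewrite opprD addrACA -scalerBr; apply: le_lt_trans (hnormD hip _ _) _.
  have := hC (x - x'); move: dx; rewrite ltr_pdivlMr ?ltr_wpDl //.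
  have := hnorm_ge0 ip (x - x'); lra.
- move=> u x hu ux e e0.
  have [|N hN] := ux (e / 2); first lra.
  have [|n [y [ny dy]]] := hu N (e / 2); first lra.
  exists n, y; split=> //; apply: le_lt_trans (hnorm_triangle hip x (u N) y) _.
  by rewrite [e]splitr ltrD // (hnormB hip); exact: hN.
Qed.

(** For [y] in a partial span, |x|^2 = <x, x - y> <= |x| |x - y|, and |x - y| can be made
    arbitrarily small. *)
Lemma closed_span_orth0 g x : closed_span g x ->
  (forall k c, rip x (c *: g k) = 0) -> x = 0.
Proof.
move=> hx h0; have nx := hnorm_ge0 ip x.
have hs n y : partial_span g n y -> rip x y = 0.
  elim: n y => [|n IH] y /=; first by move=> ->; rewrite ripE.
  by move=> [y' [c [/IH y0 ->]]]; rewrite ripE y0 h0 addr0.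
apply: (hnorm0_eq0 hip); apply/le_anti; rewrite nx andbT.
apply/ler_addgt0Pr => e e0; rewrite add0r leNgt; apply/negP => ltx.
have [n [y [/hs xy dy]]] := hx e e0.
have := rip_le hip x (x - y); rewrite !ripE xy -(hnorm_sq hip); nra.
Qed.

(** * Strict norm decrease on the span of an orthonormal sequence with orthogonal images *)

Variables (T : H -> H) (B : R).
Hypothesis Tlin : forall (a : R[i]) x y, T (a *: x + y) = a *: T x + T y.
Hypothesis Tbd : forall x, hnorm (T x) <= B * hnorm x.

Let hT : real_linear T := fun r => Tlin _.
Let TD := real_linearD hT.
Let T0 := real_linear0 hT.
Let TZ := complex_linearZ Tlin.

Variables (g : nat -> H) (s : nat -> R).
Hypothesis s1 : forall k, 0 <= s k < 1.
Hypothesis g1 : forall k, hnorm (g k) = 1.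
Hypothesis Tg : forall k, hnorm (T (g k)) = s k.
Hypothesis gO : forall j k, (j < k)%N -> forall c d, rip (c *: g j) (d *: g k) = 0.
Hypothesis TgO : forall j k, (j < k)%N ->
  forall c d, rip (T (c *: g j)) (T (d *: g k)) = 0.

Lemma partial_span_orth n y : partial_span g n y -> forall k, (n <= k)%N ->
  forall d, rip y (d *: g k) = 0 /\ rip (T y) (T (d *: g k)) = 0.
Proof.
elim: n y => [|n IH] y /=; first by move=> -> k _ d; rewrite T0 !ripE.
move=> [y' [c [/IH hy ->]]] k nk d.
have [h1 h2] := hy k (ltnW nk) d.
by rewrite TD !ripE h1 h2 gO // TgO // !addr0.
Qed.

(** For y = sum c_j g_j the gap |y|^2 - |T y|^2 is the sum of the nonnegative terms (1 - s_j^2)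
    |c_j|^2, and [rip y (g k)] is the real part of c_k, or 0 for k >= n. *)
Lemma partial_span_gap n y : partial_span g n y ->
  0 <= hnorm y ^+ 2 - hnorm (T y) ^+ 2 /\
  forall k, (1 - s k ^+ 2) * rip y (g k) ^+ 2 <= hnorm y ^+ 2 - hnorm (T y) ^+ 2.
Proof.
elim: n y => [|n IH] y /=.
  move=> ->; rewrite T0 (hnorm0 hip) subrr; split=> // k.
  by rewrite ripE expr0n mulr0.
move=> [y' [c [hy ->]]].
have [q0 qk] := IH _ hy; have [o1 o2] := partial_span_orth hy (leqnn n) c.
set m := complex.Re c ^+ 2 + complex.Im c ^+ 2.
have m0 : 0 <= m by rewrite addr_ge0 // sqr_ge0.
have -> : hnorm (y' + c *: g n) ^+ 2 = hnorm y' ^+ 2 + m.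
  have e1 := g1 n.
  rewrite !(hnorm_sq hip) !ripE (ripC hip _ y') o1 (ripZZ hip) -/m.
  by rewrite -!(hnorm_sq hip) e1; ring.
have -> : hnorm (T (y' + c *: g n)) ^+ 2 = hnorm (T y') ^+ 2 + m * s n ^+ 2.
  rewrite TD !(hnorm_sq hip) !ripE (ripC hip _ (T y')) o2 TZ (ripZZ hip) -/m.
  by rewrite -!(hnorm_sq hip) Tg; ring.
have sn k : 0 <= 1 - s k ^+ 2.
  by have := s1 k => /andP[]; nra.
have mn := mulr_ge0 m0 (sn n).
split=> [|k]; first lra.
rewrite ripE; case: (ltngtP k n) => kn.
- have -> : rip (c *: g n) (g k) = 0.
    by rewrite (ripC hip) -[g k]scale1r gO.
  have := qk k; rewrite addr0; lra.
- have -> : rip (c *: g n) (g k) = 0 by rewrite -[g k]scale1r gO.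
  have := qk k; rewrite addr0; lra.
have [o1' _] := partial_span_orth hy (leqnn n) 1.
have {}o1' : rip y' (g n) = 0 by rewrite -[g n]scale1r.
rewrite kn o1' add0r.
have -> : rip (c *: g n) (g n) = complex.Re c.
  have gi : rip ('i *: g n) (g n) = 0.
    have := rip_il (g n) (g n); rewrite (ripC hip (g n)); lra.
  by rewrite scale_ReIm !ripE gi -(hnorm_sq hip) g1 expr1n; ring.
have : complex.Re c ^+ 2 <= m by rewrite lerDl sqr_ge0.
have := sn n; nra.
Qed.

(** The gap estimate passes to the closure, where the gap of [x] is at most 0 while 1 - s_k^2 >
    0. *)
Lemma closed_span_expanding_orth x k : closed_span g x -> hnorm x = 1 ->
  1 <= hnorm (T x) -> rip x (g k) = 0.
Proof.
move=> hx x1 Tx; apply: contrapT => /eqP r0.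
set r := rip x (g k) in r0 *.
have B0 : 1 <= B by have := Tbd x; rewrite x1; lra.
have r1 : 0 < `|r| by rewrite normr_gt0.
have sk : 0 < 1 - s k ^+ 2 by have := s1 k => /andP[]; nra.
(* An approximant [y] within [e] of [x] has gap at most (3 + 2 B) e, hence at most (1 - s_k^2) r^2 /
   8 when e <= d. The bound e <= |r|/2 makes its coefficient at least |r|/2, so the gap is at least
   (1 - s_k^2) r^2 / 4. *)
pose d := (1 - s k ^+ 2) * `|r| ^+ 2 / (8 * (3 + 2 * B)).
have d0 : 0 < d by rewrite divr_gt0 ?mulr_gt0 ?exprn_gt0 //; lra.
have dE : d * (8 * (3 + 2 * B)) = (1 - s k ^+ 2) * `|r| ^+ 2.
  by rewrite divfK // gt_eqF //; lra.
pose e := Num.min 1 (Num.min (`|r| / 2) d).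
have e0 : 0 < e by rewrite !lt_min ltr01 d0 divr_gt0.
have e1 : e <= 1 by rewrite ge_min lexx.
have er : e <= `|r| / 2 by rewrite !ge_min lexx orbT.
have ed : e <= d by rewrite !ge_min lexx !orbT.
have [n [y [ny dy]]] := hx e e0.
have [_ /(_ k)] := partial_span_gap ny.
have hr : `|r| / 2 <= `|rip y (g k)|.
  have : `|rip (x - y) (g k)| <= e.
    by apply: le_trans (rip_abs_le hip _ _) _; rewrite g1 mulr1 ltW.
  rewrite !ripE -/r; have := ler_normD (r - rip y (g k)) (rip y (g k)).
  rewrite subrK; lra.
have hr2 : `|r| ^+ 2 / 4 <= rip y (g k) ^+ 2.
  by rewrite -(real_normK (num_real (rip _ _))); nra.
have hy2 : hnorm y ^+ 2 <= 1 + 3 * e.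
  have := hnorm_lip hip y x; rewrite (hnormB hip) x1.
  have := hnorm_ge0 ip y; move: (hnorm y) => Y; nra.
have hTy : 1 - B * e <= hnorm (T y).
  have := hnorm_lip hip (T x) (T y); rewrite -(real_linearB hT).
  have := Tbd (x - y); nra.
have hTy2 : 1 - 2 * (B * e) <= hnorm (T y) ^+ 2.
  move: hTy; set b := B * e; have := hnorm_ge0 ip (T y).
  move: (hnorm (T y)) => Y; nra.
have : (1 - s k ^+ 2) * (`|r| ^+ 2 / 4) <= (1 - s k ^+ 2) * rip y (g k) ^+ 2.
  by rewrite ler_pM2l.
have : B * e <= B * d by rewrite ler_wpM2l //; lra.
have : 0 < B * d by rewrite mulr_gt0 //; lra.
lra.
Qed.

(** Otherwise the previous lemma applies to both [x] and ['i *: x], so [x] is complex-orthogonal to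
    every [g k] and vanishes. *)
Lemma closed_span_not_expanding x : closed_span g x -> hnorm x = 1 ->
  hnorm (T x) < 1.
Proof.
move=> hx x1; rewrite ltNge; apply/negP => Tx.
have [M0 Mlin _] := closed_span_subspace g.
have ix : closed_span g ('i *: x) by rewrite -[_ *: x]addr0; exact: Mlin.
have h1 k := closed_span_expanding_orth k hx x1 Tx.
have h2 k : rip x ('i *: g k) = 0.
  apply: oppr_inj; rewrite -rip_il oppr0.
  by apply: closed_span_expanding_orth => //; rewrite ?TZ hnorm_i.
suff x0 : x = 0 by move: x1; rewrite x0 (hnorm0 hip) => /eqP; rewrite eq_sym oner_eq0.
apply: (closed_span_orth0 hx) => k c.
by rewrite -[x]scale1r; exact: rip_scale0.
Qed.

End NonAttaining.

(** * The dichotomy for idempotents and the conclusion *)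

Section Idempotent.
Local Set Implicit Arguments.
Local Unset Strict Implicit.
Variables (R : realType) (H : lmodType R[i]) (ip : H -> H -> R[i]).
Hypothesis hip : is_inner_product ip.

Local Notation "r *:r x" := (r%:C%C *: x) (at level 40).
Local Notation hnorm := (hnorm ip).
Local Notation rip := (rip ip).
Local Notation ripE := (ripE hip).
Local Notation rorth := (rorth ip).
Local Notation "'i" := ('i%C : R[i]).

Lemma not_abs_norm_attaining T (B : R) :
  (forall (a : R[i]) x y, T (a *: x + y) = a *: T x + T y) ->
  (forall x, hnorm (T x) <= B * hnorm x) ->
  (forall (l : seq H) (s : R), 0 < s < 1 ->
     exists g, [/\ hnorm g = 1, hnorm (T g) = s, rorth g l &
       rorth (T g) (map T l)]) ->
  ~ abs_norm_attaining ip T.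
Proof.
move=> Tlin Tbd hT.
(* These values have supremum 1, not reached; [n.+2] keeps [s 0] positive. *)
pose s n : R := 1 - n.+2%:R^-1.
have s01 n : 0 < s n < 1.
  have : 0 < n.+2%:R^-1 :> R by rewrite invr_gt0 ltr0n.
  have : n.+2%:R^-1 < 1 :> R by rewrite invf_lt1 ?ltr0n // ltr1n.
  by rewrite /s; move: n.+2%:R^-1 => a; lra.
have /choice[G hG] : forall p : seq H * nat, exists g,
    [/\ hnorm g = 1, hnorm (T g) = s p.2, rorth g p.1 & rorth (T g) (map T p.1)].
  by case=> l n; exact: hT.
(* Listing ['i *: g] beside each [g] turns the real orthogonality supplied by [hT] into complex
   orthogonality. *)
pose fix prefix n := if n is m.+1
  then let g := G (prefix m, m) in g :: 'i *: g :: prefix m else [::].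
pose g n := G (prefix n, n).
have mem_prefix j n : (j < n)%N -> g j \in prefix n /\ 'i *: g j \in prefix n.
  elim: n => // n IH; rewrite ltnS leq_eqVlt => /orP[/eqP->|/IH[h1 h2]].
    by rewrite /= !inE !eqxx orbT.
  by rewrite /= !inE h1 h2 !orbT.
have gO j k : (j < k)%N -> forall c d, rip (c *: g j) (d *: g k) = 0.
  move=> /mem_prefix[h1 h2] c d; have [_ _ hO _] := hG (prefix k, k).
  by rewrite (ripC hip); apply: (rip_scale0 hip); exact: hO.
have TZ := complex_linearZ Tlin.
have TgO j k : (j < k)%N -> forall c d, rip (T (c *: g j)) (T (d *: g k)) = 0.
  move=> /mem_prefix[h1 h2] c d; have [_ _ _ hO] := hG (prefix k, k).
  rewrite (ripC hip) !TZ; apply: (rip_scale0 hip); first exact/hO/map_f.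
  by rewrite -TZ; exact/hO/map_f.
have g1 n : hnorm (g n) = 1 by case: (hG (prefix n, n)).
have Tg n : hnorm (T (g n)) = s n by case: (hG (prefix n, n)).
have s01' n : 0 <= s n < 1 by have /andP[/ltW-> ->] := s01 n.
have Mcl := closed_span_subspace hip g.
have Mg n : closed_span ip g (g n).
  exact: (sub_closed_span hip (mem_partial_span g n)).
move=> /(_ _ Mcl) [|x [Mx [x1 Tx]]].
  exists (g 0%N); split=> // g0; have := g1 0%N; rewrite g0 (hnorm0 hip) => /eqP.
  by rewrite eq_sym oner_eq0.
have := closed_span_not_expanding hip Tlin Tbd s01' g1 Tg gO TgO Mx x1.
apply/negP; rewrite -leNgt Tx.
have [M0 _ _] := Mcl; have hsup := restr_opnorm_has_sup hip M0 Tbd.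
apply/ler_addgt0Pr => e /(@inv_succ_small R)[N /(_ N.+1 (leqnSn N))].
have : s N <= restr_opnorm ip T (closed_span ip g).
  by apply: sup_upper_bound => //; exists (g N); rewrite g1 Tg.
by rewrite /s; move: N.+2%:R^-1 => a; lra.
Qed.

(** |Q x|^2 = <T (Q x), x> <= B |Q x| |x|, divided by |Q x|. *)
Lemma adjoint_bounded T Q (B : R) :
  (forall x y, rip (T x) y = rip x (Q y)) ->
  (forall x, hnorm (T x) <= B * hnorm x) -> forall x, hnorm (Q x) <= B * hnorm x.
Proof.
move=> hTQ hB x; have [->|/eqP Q0] := eqVneq (Q x) 0.
  rewrite (hnorm0 hip); apply: le_trans (hnorm_ge0 ip _) (hB x).
have nQ := hnorm_gt0 hip Q0; have nx := hnorm_ge0 ip x.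
rewrite -(ler_pM2l nQ) -expr2 (hnorm_sq hip) -hTQ.
apply: le_trans (rip_le hip _ _) _; rewrite mulrA (mulrC _ B).
by rewrite ler_wpM2r.
Qed.

(* The unit vector g combines e in the kernel of T with f in its orthogonal
   complement, where T does not decrease norms. *)
Lemma idempotent_prescribed_norm T Q (l : seq H) (s : R) :
  real_linear T -> (forall x y, rip (T x) y = rip x (Q y)) ->
  (forall x, T (T x) = T x) ->
  (forall l, exists x, rorth (x - T x) l /\ x - T x <> 0) ->
  (forall l, exists x, rorth (Q x) l /\ Q x <> 0) ->
  0 < s < 1 ->
  exists g, [/\ hnorm g = 1, hnorm (T g) = s, rorth g l & rorth (T g) (map T l)].
Proof.
move=> Tlin hTQ hTT hK hL /andP[s0 s1].
(* The second half handles the images: <T g, T v> = <g, Q (T v)>. *)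
pose l' := l ++ map (Q \o T) l.
have [x [Kl K0]] := hK l'; have [y [Ll L0]] := hL l'.
have Te : T (x - T x) = 0 by rewrite (real_linearB Tlin) hTT subrr.
move: (x - T x) Te Kl K0 => e Te Kl K0; set f := Q y in Ll L0.
have ef : rip e f = 0 by rewrite -hTQ Te ripE.
(* As f = Q y, idempotence gives <T f, Q y> = <T f, y> = <f, Q y>; Cauchy-Schwarz then yields |f| <=
   |T f|. *)
have ff : rip (T f) f = rip f f.
  by rewrite -hTQ hTT hTQ.
have nf := hnorm_gt0 hip L0; have ne := hnorm_gt0 hip K0.
have Tf : hnorm f <= hnorm (T f).
  have := rip_le hip (T f) f; rewrite ff -(hnorm_sq hip) expr2.
  by rewrite ler_pM2r.
have nTf := lt_le_trans nf Tf.
(* [a] gives the image norm [s], since [T] kills [e]; then a |f| <= 1 leaves room for [b] to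
   complete the norm to 1. *)
pose a := s / hnorm (T f).
have a0 : 0 < a by rewrite divr_gt0.
have af : (a * hnorm f) ^+ 2 <= 1.
  have h : a * hnorm f <= 1 by rewrite mulrAC ler_pdivrMr // mul1r; nra.
  by rewrite expr_le1 // mulr_ge0 // ltW.
pose b := Num.sqrt (1 - (a * hnorm f) ^+ 2) / hnorm e.
have b2 : b ^+ 2 * hnorm e ^+ 2 = 1 - (a * hnorm f) ^+ 2.
  by rewrite -exprMn divfK ?gt_eqF // sqr_sqrtr // subr_ge0.
have lO v : v \in l' -> rip (a *:r f + b *:r e) v = 0.
  by move=> vl; rewrite !ripE (Ll v vl) (Kl v vl) !mulr0 addr0.
have TgE : T (a *:r f + b *:r e) = a *:r T f.
  by rewrite Tlin (real_linearZ _ _ Tlin) Te scaler0 addr0.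
exists (a *:r f + b *:r e); split.
- apply/eqP; rewrite -(eqrXn2 (n := 2)) ?(hnorm_ge0 ip) // (hnorm_sq hip) !ripE.
  rewrite (ripC hip f e) ef -!(hnorm_sq hip) expr1n; apply/eqP.
  by rewrite -[RHS](subrK ((a * hnorm f) ^+ 2)) -b2; ring.
- by rewrite TgE (hnormZ hip) gtr0_norm // divfK // gt_eqF.
- by move=> v vl; apply: lO; rewrite mem_cat vl.
- move=> _ /mapP[v vl ->]; rewrite hTQ.
  have -> : Q (T v) = (Q \o T) v by [].
  by apply: lO; rewrite mem_cat map_f ?orbT.
Qed.

Lemma idempotent_finite_rank_defect T Q (B : R) :
  (forall (a : R[i]) x y, T (a *: x + y) = a *: T x + T y) ->
  (forall x, hnorm (T x) <= B * hnorm x) ->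
  (forall x y, rip (T x) y = rip x (Q y)) ->
  (forall x, T (T x) = T x) -> abs_norm_attaining ip T ->
  exists l, forall x, rorth x l -> T x - Q x = 0.
Proof.
move=> Tlin Tbd hTQ hTT hAN.
have hT : real_linear T by move=> r; exact: Tlin.
have hQ := adjoint_real_linear hip hTQ.
(* Finite-dimensional kernel, which is the range of I - T: there [T] and [Q] both fix every vector
   orthogonal to a finite list. *)
have [[l hl]|nK] := pselect (exists l, forall x, rorth (x - T x) l -> x - T x = 0).
  have [r x y|x y|w hw] := @range_finite_dim R H ip hip
    (fun x => x - T x) (fun x => x - Q x) l _ _ hl.
  - by rewrite hT scalerBr opprD addrACA.
  - by rewrite !ripE hTQ.
  by exists w => x /hw[/subr0_eq Tx /subr0_eq Qx]; rewrite -Tx -Qx subrr.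
(* Finite-dimensional range of [Q]: [T] and [Q] both vanish on the vectors orthogonal to a finite
   list. *)
have [[l hl]|nL] := pselect (exists l, forall x, rorth (Q x) l -> Q x = 0).
  have [x y|w hw] := @range_finite_dim R H ip hip Q T l hQ _ hl.
    by rewrite (ripC hip) -hTQ (ripC hip).
  by exists w => x /hw[-> ->]; rewrite subrr.
exfalso; apply: (not_abs_norm_attaining Tlin Tbd _ hAN) => l s s01.
apply: (idempotent_prescribed_norm l hT hTQ hTT _ _ s01) => l'.
  apply: contrapT => h; apply: nK; exists l' => x xl.
  by apply: contrapT => x0; apply: h; exists x.
apply: contrapT => h; apply: nL; exists l' => x xl.
by apply: contrapT => x0; apply: h; exists x.
Qed.

End Idempotent.

Theorem theorem6p2 (R : realType) (H : lmodType R[i]) (ip : H -> H -> R[i])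
  (hH : separable_infdim_complex_Hilbert ip)
  (T Tadj : H -> H)
  (hT : is_bounded_operator ip T)
  (hTadj : is_adjoint ip T Tadj)
  (hidem : forall x : H, T (T x) = T x)
  (hAN : abs_norm_attaining ip T) :
  abs_norm_attaining ip (fun x : H => T x + Tadj x - x).
Proof.
have [hip hcpl _ _] := hH; have [Tlin [B Tbd]] := hT.
have hTQ x y : rip ip (T x) y = rip ip x (Tadj y) by rewrite /rip hTadj.
have Qlin := adjoint_real_linear hip hTQ.
have Qbd := adjoint_bounded hip hTQ Tbd.
have [l hl] := idempotent_finite_rank_defect hip Tlin Tbd hTQ hidem hAN.
apply: (finite_rank_defect_attaining hip (B := 2 * B + 1) hcpl _ _ _ _ hl).
- move=> r x y /=; rewrite Tlin Qlin scalerBr scalerDr.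
  by rewrite (addrACA _ (T y)) opprD [LHS]addrACA.
- by move=> r x y; rewrite Tlin Qlin scalerBr opprD addrACA.
- move=> x; have := hnormD hip (T x + Tadj x) (- x); rewrite (hnormN hip).
  have := hnormD hip (T x) (Tadj x); have := Tbd x; have := Qbd x; lra.
(* Expanding, the two sides differ by 4 <T x, T^* x> - 2 <T x, x> - 2 <T^* x, x>, and idempotence
   makes the three real products equal. *)
- move=> x; rewrite !(hnorm_sq hip) !(ripE hip).
  have h1 : rip ip (T x) (Tadj x) = rip ip (T x) x by rewrite -hTQ hidem.
  have h2 : rip ip (T x) x = rip ip (Tadj x) x by rewrite hTQ (ripC hip).
  rewrite (ripC hip (Tadj x) (T x)) (ripC hip x (T x)) (ripC hip x (Tadj x)).
  rewrite h1 h2; ring.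
Qed.
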